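(* Let $d_1,d_2\ge1$, let $S_1\subseteq\mathbb{N}^{d_1}$, $S_2\subseteq\mathbb{N}^{d_2}$ be good semigroups (not necessarily local), and let $E_1\subsetneq S_1$, $E_2\subsetneq S_2$ be proper good ideals. Put $S=S_1\times S_2\subseteq\mathbb{N}^{d_1+d_2}$, $E=E_1\times E_2$ (a good ideal of $S$) and $A=S\setminus E$, and let $\lambda_1:S_1\to\mathbb N$, $\lambda_2:S_2\to\mathbb N$ be the level functions of $S_1$, $S_2$ with respect to $S_1\setminus E_1$ and $S_2\setminus E_2$. Then for every $(\boldsymbol\alpha^{(1)},\boldsymbol\alpha^{(2)})\in A$, the level of $A$ containing $(\boldsymbol\alpha^{(1)},\boldsymbol\alpha^{(2)})$ is $A_k$ with $$k=\lambda_1(\boldsymbol\alpha^{(1)})+\lambda_2(\boldsymbol\alpha^{(2)})-1.$$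
   Context: Notation: on $\mathbb{Z}^d$, $\le$ is componentwise, $\boldsymbol\alpha<\boldsymbol\beta$ means $\le$ and $\ne$, $\boldsymbol\alpha\ll\boldsymbol\beta$ means $\alpha_i<\beta_i$ for all $i$, $\boldsymbol\alpha\le\le\boldsymbol\beta$ means $\boldsymbol\alpha=\boldsymbol\beta$ or $\boldsymbol\alpha\ll\boldsymbol\beta$, $\boldsymbol\alpha\wedge\boldsymbol\beta$ componentwise minimum, $I=\{1,\dots,d\}$, $\Delta^T_F(\boldsymbol\alpha)=\{\boldsymbol\beta\in T:\beta_i=\alpha_i\ (i\in F),\ \beta_j>\alpha_j\ (j\notin F)\}$. A good semigroup is a submonoid $S$ of $(\mathbb{N}^d,+)$ with (G1) closure under $\wedge$; (G2) if $\boldsymbol\alpha\neq\boldsymbol\beta\in S$ with $\alpha_i=\beta_i$, there is $\boldsymbol\epsilon\in S$ with $\epsilon_i>\alpha_i$, $\epsilon_j\ge\min\{\alpha_j,\beta_j\}$ for $j\ne i$, with equality if $\alpha_j\ne\beta_j$; (G3) $\boldsymbol c+\mathbb N^d\subseteq S$ for some $\boldsymbol c$. A good ideal is $E\subseteq S$ with $E+S\subseteq E$ satisfying (G1)–(G3). For $d=1$ good semigroups are numerical semigroups. Levels of $A=S\setminus E$ ($E$ a proper good ideal): $\boldsymbol\alpha\in B$ is a complete infimum of $\boldsymbol\beta^{(1)},\dots,\boldsymbol\beta^{(r)}\in B$ ($r\ge2$) if $\boldsymbol\beta^{(j)}\in\Delta^S_{F_j}(\boldsymbol\alpha)$ with $\emptyset\ne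 F_j\subsetneq I$, pairwise infima equal $\boldsymbol\alpha$, and $\bigcap F_j=\emptyset$. $B^{(1)}$ = maximal elements of $A$ for $\le\le$, $C^{(1)}$ = those that are complete infima of $r$ elements of $B^{(1)}$ ($1<r\le d$), $D^{(1)}=B^{(1)}\setminus C^{(1)}$; inductively $B^{(i)}$ = maximal elements for $\le\le$ of $A\setminus\bigcup_{j<i}D^{(j)}$, and $C^{(i)},D^{(i)}$ likewise; $A=\bigsqcup_{i=1}^ND^{(i)}$ and the levels are $A_i=D^{(N+1-i)}$. (For $d=1$, $A=\{w_1<\dots<w_N\}$ is finite and $A_i=\{w_i\}$.) Level function: for a good semigroup $T$ and $A=T\setminus E$ with levels $A_1,\dots,A_N$, $\lambda:T\to\{1,\dots,N+1\}$ is $\lambda(\boldsymbol\alpha)=i$ if $\boldsymbol\alpha\in A_i$, and $\lambda(\boldsymbol\alpha)=1+\max\{i:\boldsymbol\alpha>\boldsymbol\theta\text{ for some }\boldsymbol\theta\in A_i\}$ if $\boldsymbol\alpha\notin A$. *)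

(* Defs.v *)
From mathcomp Require Import all_boot.
Set Implicit Arguments. Unset Strict Implicit. Unset Printing Implicit Defensive.

Definition vec (d : nat) := {ffun 'I_d -> nat}.
Definition vset (d : nat) := vec d -> Prop.

Section Defs.
Variable d : nat.
Implicit Types (a b e : vec d) (S E A R : vset d).

Definition vle a b := forall i, a i <= b i.
Definition vlt a b := vle a b /\ a <> b.
Definition vll a b := forall i, a i < b i.
Definition vmeet a b : vec d := [ffun i => minn (a i) (b i)].
Definition vadd a b : vec d := [ffun i => a i + b i].
Definition vzero : vec d := [ffun _ => 0].

Definition G1 S := forall a b, S a -> S b -> S (vmeet a b).
Definition G2 S := forall a b, S a -> S b -> a <> b -> forall i, a i = b i ->
  exists e, S e /\ a i < e i /\
    forall j, j != i -> minn (a j) (b j) <= e j /\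
                        (a j <> b j -> e j = minn (a j) (b j)).
Definition G3 S := exists c, forall a, vle c a -> S a.

Definition good_semigroup S :=
  [/\ S vzero, (forall a b, S a -> S b -> S (vadd a b)), G1 S, G2 S & G3 S].

Definition good_ideal S E :=
  [/\ (forall a, E a -> S a), (forall a b, E a -> S b -> E (vadd a b)),
      G1 E, G2 E & G3 E].

Definition proper_in S E := exists a, S a /\ ~ E a.

Definition Delta (T : vset d) (F : {set 'I_d}) a b :=
  T b /\ forall i, (i \in F -> b i = a i) /\ (i \notin F -> a i < b i).

Definition complete_inf S (B : vset d) (r : nat) a :=
  B a /\ exists (be : 'I_r -> vec d) (F : 'I_r -> {set 'I_d}),
    [/\ forall j, B (be j),
        forall j, Delta S (F j) a (be j),
        forall j, F j != set0 /\ F j != [set: 'I_d],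
        forall j j', j != j' -> vmeet (be j) (be j') = a
      & \bigcap_(j < r) F j = set0].

Definition maxel (R : vset d) a := R a /\ forall b, R b -> ~ vll a b.

Definition Cset S R a :=
  exists r, 1 < r <= d /\ complete_inf S (maxel R) r a.
Definition Dset S R a := maxel R a /\ ~ Cset S R a.

Fixpoint remA S A (n : nat) : vset d :=
  match n with
  | 0 => A
  | n'.+1 => fun a => remA S A n' a /\ ~ Dset S (remA S A n') a
  end.

(* D^(i) (i >= 1) is Dset S (remA S A (i-1)) *)
(* N is the number of steps: A = D^(1) u ... u D^(N), each step nonempty *)
Definition nlevels S A (N : nat) :=
  (forall a, ~ remA S A N a) /\ (forall n, n < N -> exists a, remA S A n a).

(* the k-th level A_k = D^(N+1-k), 1 <= k <= N *)
Definition level_set S A N k a :=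
  0 < k <= N /\ Dset S (remA S A (N - k)) a.

Definition in_level S A k a := exists N, nlevels S A N /\ level_set S A N k a.

(* level function lambda : T -> {1,...,N+1} for A = T \ E *)
Definition level_fun S A a (k : nat) :=
  exists N, nlevels S A N /\
  ((A a /\ level_set S A N k a) \/
   (~ A a /\ (exists t, level_set S A N k.-1 t /\ vlt t a) /\
    (forall i t, level_set S A N i t -> vlt t a -> i <= k.-1))).

End Defs.

Definition vleft d1 d2 (x : vec (d1 + d2)) : vec d1 := [ffun j => x (lshift d2 j)].
Definition vright d1 d2 (x : vec (d1 + d2)) : vec d2 := [ffun j => x (rshift d1 j)].
Definition vconcat d1 d2 (a : vec d1) (b : vec d2) : vec (d1 + d2) :=
  [ffun i => match split i with inl j => a j | inr j => b j end].
Definition sprod d1 d2 (S1 : vset d1) (S2 : vset d2) : vset (d1 + d2) :=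
  fun x => S1 (vleft x) /\ S2 (vright x).
Definition sdiff d (S E : vset d) : vset d := fun x => S x /\ ~ E x.

(* Main.v *)
(** Say that an element of S ascends n+1 times if in every coordinate it is
    exceeded by some element of A = S \ E that lies above it and ascends n
    times. Supports of elements of S above a given element form a Boolean
    algebra, so complete infima only express that every coordinate can be
    raised, and what remains of A after n removals is the set of its elements
    ascending n times. Beyond A, an element of E ascends n times exactly when
    all elements of A below it do, which is how the level function treats E;
    this rests on a simultaneous induction ([below_ideal], [above_ideal]) on
    pairs formed by an element of A and an element of E. In a product, raising
    one coordinate affects one factor only, so the numbers of ascents add up,
    with one extra ascent when both components lie outside the ideals. *)
Require Import Defs.
From Stdlib Require Import Classical.
From mathcomp Require Import all_boot zify.

Set Implicit Arguments. Unset Strict Implicit. Unset Printing Implicit Defensive.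

Lemma minimizer (T : Type) (P : T -> Prop) (f : T -> nat) :
  (exists x, P x) -> exists x, P x /\ forall y, P y -> f x <= f y.
Proof.
case=> x; have [n] := ubnP (f x); elim: n x => // n IHn x lt_x Px.
have [[y [Py lt_yx]]|noy] := classic (exists y, P y /\ f y < f x).
  by apply: (IHn y) => //; lia.
exists x; split=> // y Py; rewrite leqNgt; apply/negP => lt_yx.
by case: noy; exists y.
Qed.

(** * Componentwise order, weights and least elements *)

Section Vectors.
Variable d : nat.
Implicit Types a b c : vec d.

Lemma vle_trans b a c : vle a b -> vle b c -> vle a c.
Proof. by move=> ab bc i; apply: leq_trans (ab i) (bc i). Qed.

Lemma vle_anti a b : vle a b -> vle b a -> a = b.
Proof. by move=> ab ba; apply/ffunP => i; apply/eqP; rewrite eqn_leq ab ba. Qed.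

Lemma vmeetE a b i : vmeet a b i = minn (a i) (b i).
Proof. by rewrite ffunE. Qed.

Lemma vmeetC a b : vmeet a b = vmeet b a.
Proof. by apply/ffunP => i; rewrite !vmeetE minnC. Qed.

Lemma vmeet_lel a b : vle (vmeet a b) a.
Proof. by move=> i; rewrite vmeetE geq_minl. Qed.

Lemma vmeet_ler a b : vle (vmeet a b) b.
Proof. by move=> i; rewrite vmeetE geq_minr. Qed.

Lemma vle_meet a b c : vle a b -> vle a c -> vle a (vmeet b c).
Proof. by move=> ab ac i; rewrite vmeetE leq_min ab ac. Qed.

Lemma vlt_coord a b : vlt a b -> exists i, a i < b i.
Proof.
move=> [ab neq]; apply: NNPP => no; apply: neq; apply: vle_anti => // i.
by rewrite leqNgt; apply/negP => lt; apply: no; exists i.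
Qed.

Lemma coord_neq a b i : a i < b i -> a <> b.
Proof. by move=> lt eq_ab; rewrite eq_ab ltnn in lt. Qed.

Definition weight a := \sum_i a i.

Lemma weight_le a b : vle a b -> weight a <= weight b.
Proof. by move=> ab; apply: leq_sum => i _. Qed.

Lemma weight_lt a b i : vle a b -> a i < b i -> weight a < weight b.
Proof.
move=> ab lt; rewrite /weight (bigD1 i) //= [X in _ < X](bigD1 i) //=.
by rewrite -addSn leq_add // leq_sum.
Qed.

(** For comparable elements the minima in (G2) are the coordinates of [a], so the new element stays
    above [a] and equals it wherever [b] is strictly larger. *)
Lemma G2_above (T : vset d) a b i : G2 T -> T a -> T b -> vle a b -> a <> b ->
  a i = b i -> exists e, [/\ T e, vle a e, a i < e i &
    forall j, a j < b j -> e j = a j].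
Proof.
move=> g2 Ta Tb ab neq eqi; have [e [Te [lti He]]] := g2 _ _ Ta Tb neq i eqi.
have mE j : minn (a j) (b j) = a j by apply/minn_idPl.
exists e; split=> // [j|j ltj].
- have [->|nji] := eqVneq j i; first exact: ltnW.
  by have [] := He j nji; rewrite mE.
- have nji : j != i by apply: contraTneq ltj => ->; rewrite eqi ltnn.
  by have [_] := He j nji; rewrite mE; apply=> eqj; rewrite eqj ltnn in ltj.
Qed.

(** The meet of two candidates is again a candidate, so one of minimal weight lies below all
    others. *)
Lemma least_above (S : vset d) a i : G1 S ->
  (exists x, [/\ S x, vle a x & a i < x i]) ->
  exists x, [/\ S x, vle a x, a i < x i &
    forall y, S y -> vle a y -> a i < y i -> vle x y].
Proof.
move=> g1 /(minimizer weight) [x [[Sx ax ltx] minx]].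
exists x; split=> // y Sy ay lty j; rewrite leqNgt; apply/negP => ltj.
have : weight x <= weight (vmeet x y).
  by apply: minx; split; [apply: g1|apply: vle_meet|rewrite vmeetE leq_min ltx].
rewrite leqNgt => /negP; apply; apply: (@weight_lt _ _ j); first exact: vmeet_lel.
by rewrite vmeetE; lia.
Qed.

End Vectors.

(** * Counting ascents *)

Section Ascent.
Variables (d : nat) (S A : vset d).

(* On [A], [ascent n] will turn out to be [remA S A n]; off [A] it extends the
   level function to the ideal. *)
Fixpoint ascent (n : nat) : vset d :=
  match n with
  | 0 => S
  | n'.+1 => fun a => S a /\
      forall i, exists g, [/\ A g, ascent n' g, vle a g & a i < g i]
  end.

Lemma ascent_sub n a : ascent n a -> S a.
Proof. by case: n => [|n] //= []. Qed.

Lemma ascent_down n a b : S a -> vle a b -> ascent n b -> ascent n a.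
Proof.
case: n => [|n] //= Sa ab [_ Hb]; split=> // i; have [g [Ag ng bg lt]] := Hb i.
by exists g; split=> //; [apply: vle_trans bg | apply: leq_ltn_trans (ab i) lt].
Qed.

Hypothesis d_gt0 : 0 < d.

Lemma ascentS n a : ascent n.+1 a -> ascent n a.
Proof.
move=> [Sa Ha]; have [g [_ ng ag _]] := Ha (Ordinal d_gt0).
exact: ascent_down ng.
Qed.

Lemma ascent_le m n a : m <= n -> ascent n a -> ascent m a.
Proof.
move=> /subnK <-; elim: (n - m) => // k IHk; rewrite addSn => /ascentS; exact: IHk.
Qed.

Lemma ascent_max N a : S a -> ~ ascent N a ->
  exists n, [/\ n < N, ascent n a & ~ ascent n.+1 a].
Proof.
move=> Sa; elim: N => // N IHN nN.
have [aN|naN] := classic (ascent N a); first by exists N.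
by have [n [ltn an nan]] := IHN naN; exists n; split=> //; apply: ltnW.
Qed.

End Ascent.

(** * Removal of levels in terms of ascents *)

Section Removal.
Variables (d : nat) (S E : vset d).
Hypotheses (d_gt0 : 0 < d) (g1S : G1 S) (g2S : G2 S) (g1E : G1 E).
Let A := sdiff S E.

Section Remainder.
Variable R : vset d.
Hypothesis R_A : forall a, R a -> A a.
Hypothesis R_down : forall a b, A a -> vle a b -> R b -> R a.

(** If [a] is not maximal, a single element exceeds it everywhere. If it is a complete infimum, the
    sets [F j] have empty intersection, so [i] misses some [F j] and [be j] is larger at [i]. *)
Lemma not_Dset_rises a : R a -> ~ Dset S R a ->
  forall i, exists g, [/\ R g, vle a g & a i < g i].
Proof.
move=> Ra nD i; have [[_ maxa]|nmax] := classic (maxel R a); last first.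
  have [b [Rb ab]] : exists b, R b /\ vll a b.
    apply: NNPP => no; apply: nmax; split=> // b Rb ab; apply: no; by exists b.
  by exists b; split=> // j; apply: ltnW.
have [r [_ [_ [be [F [Rbe Dbe _ _ F0]]]]]] : Cset S R a.
  by apply: NNPP => nC; apply: nD.
have /bigcapP : i \notin \bigcap_(j < r) F j by rewrite F0 inE.
move=> nall; have [j niF] : exists j, i \notin F j.
  apply: NNPP => no; apply: nall => j _; apply: contraT => niF.
  by case: no; exists j.
exists (be j); have [Sb Hb] := Dbe j; split; first by have [] := Rbe j.
  move=> k; have [eqk ltk] := Hb k.
  by have [/eqk->|/ltk/ltnW] := boolP (k \in F j).
by have [_ ->] := Hb i.
Qed.

(* The least elements [mu i] of S above a with larger i-th coordinate have
   supports partitioning the index set; two of them with disjoint supports meet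
   in a, so at most one of them can lie in E. *)
Lemma rises_not_Dset a : R a ->
  (forall i, exists g, [/\ R g, vle a g & a i < g i]) -> ~ Dset S R a.
Proof.
move=> Ra rise [maxa]; apply.
have [Sa nEa] := R_A Ra.
have /fin_all_exists [mu Hmu] : forall i, exists x, [/\ S x, vle a x, a i < x i &
    forall y, S y -> vle a y -> a i < y i -> vle x y].
  move=> i; apply: least_above => //; have [g [/R_A[Sg _] ag lt]] := rise i.
  by exists g.
have muS i : S (mu i) by have [] := Hmu i.
have mu_ge i : vle a (mu i) by have [] := Hmu i.
have mu_lt i : a i < mu i i by have [] := Hmu i.
have mu_min i y : S y -> vle a y -> a i < y i -> vle (mu i) y.
  by have [_ _ _ H] := Hmu i; apply: H.
(* If [mu j] agreed with [a] at [i], (G2) would raise [i] while keeping coordinate [j] at [a j],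
   against the minimality of [mu i]. *)
have mu_eq i j : a j < mu i j -> mu i = mu j.
  move=> ltj; have le_ji : vle (mu j) (mu i) by apply: mu_min.
  apply: vle_anti => //; apply: (mu_min i) => //.
  have := mu_ge j i; rewrite leq_eqVlt => /orP [/eqP eqi|//]; exfalso.
  have [e [Se ae lti He]] := G2_above g2S Sa (muS j) (mu_ge j)
    (coord_neq (mu_lt j)) eqi.
  have := mu_min i e Se ae lti j; rewrite (He j (mu_lt j)).
  by move: ltj; lia.
have mu_meet i j : mu i <> mu j -> vmeet (mu i) (mu j) = a.
  move=> neq; apply: vle_anti; last exact: vle_meet.
  move=> k; rewrite vmeetE leqNgt leq_min; apply/negP => /andP [ki kj].
  by apply: neq; rewrite (mu_eq i k) // (mu_eq j k).
(* [mu i0] is the only least element that can lie in [E]; the element [g] of [R] chosen next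
   replaces it. *)
have [i0 Hi0] : exists i0, forall j, mu j <> mu i0 -> ~ E (mu j).
  have [[i Ei]|noE] := classic (exists i, E (mu i)); last first.
    by exists (Ordinal d_gt0) => j _ Ej; apply: noE; exists j.
  by exists i => j neq Ej; apply: nEa; rewrite -(mu_meet _ _ neq); apply: g1E.
have [g [Rg ag ltg]] := rise i0; have [Sg _] := R_A Rg.
have g_supp j k : mu j = mu k -> a j < g j -> a k < g k.
  move=> eq_jk ltj; apply: leq_trans (mu_lt k) _; rewrite -eq_jk.
  exact: (mu_min j).
pose Z := [set j | a j == g j].
have inZ j : j \in Z = ~~ (a j < g j).
  by rewrite inE; have := ag j; case: ltngtP.
(* [g] exceeds [a] on the whole support of [mu i0], so [mu j] differs from [mu i0] and avoids [E];
   being below some [h] in [R], it lies in [R]. *)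
have muR j : j \in Z -> R (mu j).
  rewrite inZ => /negP Zj; have [h [Rh ah lth]] := rise j.
  have [Sh _] := R_A Rh; apply: (R_down (b := h)) => //; last exact: mu_min.
  split=> //; apply: Hi0 => eq_j; apply: Zj; exact: (g_supp i0).
have g_meet j : j \in Z -> vmeet g (mu j) = a.
  rewrite inZ => /negP Zj; apply: vle_anti; last exact: vle_meet.
  move=> k; rewrite vmeetE leqNgt leq_min; apply/negP => /andP [kg kj].
  by apply: Zj; apply: (g_supp k) => //; rewrite (mu_eq j k).
(* The family with complete infimum [a]: [g] for its own support, the distinct [mu j] for the other
   coordinates. *)
pose s := g :: undup [seq mu j | j <- enum Z].
have s_mem x : x \in s -> x = g \/ exists2 j, j \in Z & x = mu j.
  rewrite inE mem_undup => /orP [/eqP|/mapP [j]]; first by left.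
  by rewrite mem_enum; right; exists j.
have g_nmu j : j \in Z -> g <> mu j.
  by rewrite inZ => Zj eqg; move: Zj; rewrite eqg mu_lt.
have s_uniq : uniq s.
  rewrite /= undup_uniq andbT mem_undup; apply/mapP => -[j].
  by rewrite mem_enum => /g_nmu.
have s_meet x y : x \in s -> y \in s -> x <> y -> vmeet x y = a.
  move=> /s_mem [->|[j Zj ->]] /s_mem [->|[k Zk ->]] // neq.
  - exact: g_meet.
  - by rewrite vmeetC; apply: g_meet.
  - exact: mu_meet.
have s_R x : x \in s -> R x.
  by move=> /s_mem [->//|[j Zj ->]]; apply: muR.
have s_ge x : x \in s -> vle a x.
  by move=> /s_mem [->//|[j Zj ->]]; apply: mu_ge.
have s_sup x : x \in s -> exists i, a i < x i.
  by move=> /s_mem [->|[j Zj ->]]; [exists i0 | exists j].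
have s_eqc x : x \in s -> exists i, a i = x i.
  move=> sx; apply: NNPP => no; case: maxa => _ /(_ x (s_R x sx)); apply=> i.
  have := s_ge x sx i; rewrite leq_eqVlt => /orP [/eqP eqi|//].
  by case: no; exists i.
have s_cover i : exists2 x, x \in s & a i < x i.
  have [Zi|] := boolP (i \in Z); last first.
    by rewrite inZ negbK; exists g; rewrite // inE eqxx.
  exists (mu i) => //; rewrite inE mem_undup; apply/orP; right; apply/mapP.
  by exists i; rewrite ?mem_enum.
have nth_s (j : 'I_(size s)) : nth a s j \in s by apply: mem_nth.
exists (size s); split; last first.
  split=> //; exists (fun j => nth a s j), (fun j => [set i | nth a s j i == a i]).
  split.
  - move=> j; split; first exact: s_R.
    move=> b Rb lt; case: maxa => _ /(_ b Rb); apply=> i.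
    exact: leq_ltn_trans (s_ge _ (nth_s j) i) (lt i).
  - move=> j; split; first by have [] := R_A (s_R _ (nth_s j)).
    move=> i; rewrite inE; split; first by move/eqP.
    by move=> neq; rewrite ltn_neqAle eq_sym neq (s_ge _ (nth_s j)).
  - move=> j; split.
      by have [i eqi] := s_eqc _ (nth_s j); apply/set0Pn; exists i; rewrite inE eqi.
    have [i lti] := s_sup _ (nth_s j); apply/eqP => /setP /(_ i).
    by rewrite !inE => /eqP eqi; rewrite eqi ltnn in lti.
  - move=> j j' neq; apply: s_meet => //; apply/eqP.
    by rewrite nth_uniq //; apply: contra neq => /eqP eqj; apply/eqP/val_inj.
  - apply/setP => i; rewrite inE; apply/bigcapP => inF.
    have [x sx lti] := s_cover i; have ltx : index x s < size s by rewrite index_mem.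
    by have := inF (Ordinal ltx) isT; rewrite inE /= nth_index // gtn_eqF.
(* For [1 < r <= d]: [Z] is nonempty since [g] agrees with [a] somewhere, it misses [i0], and [g]
   adds one to at most [#|Z|] vectors. *)
have Zn0 : 0 < #|Z|.
  have [|i eqi] := s_eqc g; first by rewrite inE eqxx.
  by apply/card_gt0P; exists i; rewrite inE eqi.
have ZC : #|Z| < d.
  rewrite -[X in _ < X]card_ord -cardsT; apply: proper_card.
  rewrite properT; apply/eqP => /setP /(_ i0).
  by rewrite inZ ltg inE.
have := size_undup [seq mu j | j <- enum Z]; rewrite size_map -cardE => le_sz.
have : 0 < size (undup [seq mu j | j <- enum Z]).
  have /card_gt0P [j Zj] := Zn0; rewrite lt0n size_eq0; apply/eqP => sz0.
  have : mu j \in undup [seq mu j | j <- enum Z].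
    by rewrite mem_undup; apply/mapP; exists j; rewrite ?mem_enum.
  by rewrite sz0.
by move=> sz0; rewrite /= ltnS sz0; apply: leq_ltn_trans le_sz ZC.
Qed.

End Remainder.

(** By induction each remainder is downward closed in [A], which lets the two preceding lemmas turn
    one removal into one ascent. *)
Lemma remA_ascent n a : remA S A n a <-> A a /\ ascent S A n a.
Proof.
elim: n a => [|n IHn] a.
  by split=> [Aa|[]//]; split=> //; case: Aa.
have RA b : remA S A n b -> A b by move=> /IHn [].
have Rdown b c : A b -> vle b c -> remA S A n c -> remA S A n b.
  move=> Ab bc /IHn [_ nc]; apply/IHn; split=> //; apply: ascent_down nc => //.
  by case: Ab.
split=> [[Ra nD]|[Aa na]].
  have [Aa na] := (IHn a).1 Ra; split=> //; split; first by case: Aa.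
  move=> i; have [g [/IHn [Ag ng] ag lt]] := not_Dset_rises Ra nD i.
  by exists g.
have Ra : remA S A n a by apply/IHn; split=> //; apply: ascentS na.
split=> //; apply: rises_not_Dset => // i; have [g [Ag ng ag lt]] := na.2 i.
by exists g; split=> //; apply/IHn.
Qed.

Lemma Dset_ascent n a : Dset S (remA S A n) a <->
  [/\ A a, ascent S A n a & ~ ascent S A n.+1 a].
Proof.
split=> [Da|[Aa na nSa]].
  have [Aa na] := (remA_ascent n a).1 Da.1.1; split=> // nSa.
  by have [_] := (remA_ascent n.+1 a).2 (conj Aa nSa).
apply: NNPP => nD; apply: nSa; apply: ((remA_ascent n.+1 a).1 _).2.
by split=> //; apply/remA_ascent.
Qed.

End Removal.

(** * Ascents of elements of the ideal *)

Section Ideal.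
Variables (d : nat) (S E : vset d).
Hypotheses (d_gt0 : 0 < d) (g1S : G1 S) (g2S : G2 S) (g1E : G1 E) (g2E : G2 E).
Hypothesis E_S : forall a, E a -> S a.
Let A := sdiff S E.

(** Either a given [g] raises coordinate [j], or all of them agree with [x] there. Then (G2) lifts
    [j] with any one [p] of [P] fixed, so the least lift [y] fixes all of [P] and stays in [X].
    Ascending from [g] at [j] gives elements above [y] that raise [p], so induction on [n] applies
    to [y]. *)
Lemma ascent_pinned (X : vset d) (P : pred 'I_d) :
    (forall x, X x -> A x) ->
    (forall x y, X x -> S y -> vle x y -> (forall p, P p -> y p = x p) -> X y) ->
    (exists p, P p) ->
  forall n x, X x ->
    (forall p, P p -> exists g, [/\ A g, ascent S A n g, vle x g & x p < g p]) ->
  ascent S A n.+1 x.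
Proof.
move=> X_A X_up [p0 Pp0].
have push x j : X x ->
    (forall p, P p -> exists g, [/\ S g, vle x g, x p < g p & x j = g j]) ->
    exists y, [/\ X y, vle x y, x j < y j, forall p, P p -> y p = x p &
      forall z, S z -> vle x z -> x j < z j -> vle y z].
  move=> Xx Hx; have [Sx _] := X_A x Xx.
  have lift p : P p -> exists y, [/\ S y, vle x y, x j < y j & y p = x p].
    move=> /Hx [g [Sg xg lt eqj]].
    have [y [Sy xy ltj Hy]] := G2_above g2S Sx Sg xg (coord_neq lt) eqj.
    by exists y; split=> //; apply: Hy.
  have [y [Sy xy ltj miny]] : exists y, [/\ S y, vle x y, x j < y j &
      forall z, S z -> vle x z -> x j < z j -> vle y z].
    apply: least_above => //; have [y [Sy xy ltj _]] := lift p0 Pp0; by exists y.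
  have yP p : P p -> y p = x p.
    move=> /lift [z [Sz xz ltzj eqz]].
    by apply/eqP; rewrite eqn_leq xy andbT -eqz; apply: miny.
  by exists y; split=> //; apply: (X_up x).
elim=> [|n IHn] x Xx Hx; have [Sx _] := X_A x Xx; split=> // j; apply: NNPP => no.
all: have [|y [Xy xy ltj yP miny]] := push x j Xx.
- move=> p /Hx [g [Ag ng xg lt]]; exists g; split; [exact: Ag.1 | by [] | by [] |].
  have := xg j; rewrite leq_eqVlt => /orP [/eqP //|ltj]; case: no; by exists g.
- by apply: no; exists y; split=> //; [apply: X_A | case: (X_A _ Xy)].
- move=> p /Hx [g [Ag ng xg lt]]; exists g; split; [exact: Ag.1 | by [] | by [] |].
  have := xg j; rewrite leq_eqVlt => /orP [/eqP //|ltj]; case: no; by exists g.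
apply: no; exists y; split=> //; first exact: X_A.
apply: IHn => // p Pp; have [g [Ag ng xg lt]] := Hx p Pp.
have [h [Ah nh gh lth]] := ng.2 j.
have yh : vle y h.
  apply: miny; [by case: Ah | exact: vle_trans xg gh | exact: leq_ltn_trans (xg j) lth].
by exists h; split=> //; rewrite yP //; apply: leq_trans lt (gh p).
Qed.

(** A form of (G2) that stays in [A] and loses no ascents. Its step uses both statements at smaller
    counts, while the step for [above_ideal] uses [below_ideal] at the same count. *)
Let below_ideal m := forall a b i, A a -> ascent S A m a -> E b -> vle a b ->
  a i = b i -> exists e, [/\ A e, ascent S A m e, vle a e & a i < e i].

Let above_ideal m := forall b a, E b -> A a -> ascent S A m a -> vle b a ->
  ascent S A m.+1 b.

Lemma sdiff_neq a b : A a -> E b -> a <> b.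
Proof. by move=> [_ nEa] Eb eq_ab; apply: nEa; rewrite eq_ab. Qed.

(** Elements of [X] meet [b] in [a], which is outside [E], so [X] lies in [A]. The least [x] raising
    [i] is in [X], and [ascent_pinned] applies to the coordinates where [b] exceeds [a]. *)
Lemma below_ideal_step m :
  (forall k, k < m -> below_ideal k /\ above_ideal k) -> below_ideal m.
Proof.
move=> IH a b i Aa ma Eb ab eqi; have [Sa nEa] := Aa.
have neq := sdiff_neq Aa Eb.
pose X x := [/\ S x, vle a x, a i < x i & forall p, a p < b p -> x p = a p].
have X_A x : X x -> A x.
  move=> [Sx ax ltx xP]; split=> // Ex; apply: nEa.
  suff -> : a = vmeet x b by apply: g1E.
  apply/ffunP => j; rewrite vmeetE; have := ab j.
  rewrite leq_eqVlt => /orP [/eqP eqj|ltj].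
    by apply/esym; rewrite -eqj; apply/minn_idPr; apply: ax.
  by rewrite (xP j ltj); apply/esym/minn_idPl; apply: ltnW.
have [e [Se ae lte eP]] := G2_above g2S Sa (E_S Eb) ab neq eqi.
have [x [Sx ax ltx minx]] : exists x, [/\ S x, vle a x, a i < x i &
    forall y, S y -> vle a y -> a i < y i -> vle x y].
  by apply: least_above => //; exists e.
have Xx : X x.
  split=> // p ltp; apply/eqP; rewrite eqn_leq ax andbT -(eP p ltp).
  exact: minx.
exists x; split=> //; first exact: X_A.
case: m IH ma => [|m] IH ma //.
have [IHb IHa] := IH m (leqnn _).
apply: (@ascent_pinned X (fun p => a p < b p)) => //.
- move=> u v [Su au ltu uP] Sv uv vP; split=> //.
  + exact: vle_trans uv.
  + exact: leq_trans (uv i).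
  + by move=> p ltp; rewrite vP // uP.
- exact: vlt_coord.
move=> p ltp; have [g [Ag mg ag ltg]] := ma.2 p.
(* [s] raises [p] but not [i]. It is raised at [i] by [above_ideal] if it lies in [E], by
   [below_ideal] otherwise; the result lies above [x] by minimality. *)
pose s := vmeet g b.
have as_ : vle a s by apply: vle_meet.
have Ss : S s by apply: g1S; [case: Ag | apply: E_S].
have si : s i = a i.
  by rewrite vmeetE -eqi; apply/minn_idPr; apply: ag.
have sp : a p < s p by rewrite vmeetE leq_min ltg.
suff [h [Ah mh sh lth]] : exists h, [/\ A h, ascent S A m h, vle s h & s i < h i].
  have ah := vle_trans as_ sh.
  have xh : vle x h by apply: minx => //; [case: Ah | rewrite -si].
  have [_ _ _ xP] := Xx.
  by exists h; split=> //; rewrite xP //; apply: leq_trans sp (sh p).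
have [Es|nEs] := classic (E s).
  exact: (IHa s g Es Ag mg (vmeet_lel _ _)).2.
apply: (IHb s b i) => //; last by rewrite si.
- exact: ascent_down (vmeet_lel _ _) mg.
- exact: vmeet_ler.
Qed.

(** Inner induction on the weight gap; where [a] exceeds [b], [a] itself is the witness. At the
    other coordinates, either [X] stays in [A] and yields a witness, or it meets [E] and (G2) inside
    [E] leads to a larger [s] below [a]. *)
Lemma above_ideal_step m : below_ideal m -> above_ideal m.
Proof.
move=> below b a; have [k] := ubnP (weight a - weight b).
elim: k b => // k IHk b ltk Eb Aa ma ba; have [Sa nEa] := Aa.
have Sb := E_S Eb; split=> // i.
have := ba i; rewrite leq_eqVlt => /orP [/eqP eqi|lti]; last by exists a.
have neq : b <> a by move=> eq_ba; apply: sdiff_neq Aa Eb _; rewrite eq_ba.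
pose X x := [/\ S x, vle b x, b i < x i & forall p, b p < a p -> x p = b p].
have [X_A|] := classic (forall x, X x -> A x).
  have [e [Se be lte eP]] := G2_above g2S Sb Sa ba neq eqi.
  case: m below IHk ma => [|m] below IHk ma.
    by exists e; split=> //; apply: X_A.
  have [g [Ag mg ag ltg]] := ma.2 i.
  have bg := vle_trans ba ag.
  (* Meeting with [g] keeps [x] below an element with [m] ascents, and this one [g] serves every
     pinned coordinate. *)
  pose x := vmeet e g.
  have Xx : X x.
    split.
    - by apply: g1S => //; case: Ag.
    - exact: vle_meet.
    - by rewrite vmeetE leq_min lte eqi.
    - by move=> p ltp; rewrite vmeetE eP //; apply/minn_idPl; apply: bg.
  exists x; split=> //; [exact: X_A | | by case: Xx | by case: Xx].
  apply: (@ascent_pinned X (fun p => b p < a p)) => //.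
  - move=> u v [Su bu ltu uP] Sv uv vP; split=> //.
    + exact: vle_trans uv.
    + exact: leq_trans (uv i).
    + by move=> p ltp; rewrite vP // uP.
  - exact: vlt_coord.
  move=> p ltp; exists g; split=> //; first exact: vmeet_ler.
  by case: Xx => _ _ _ -> //; apply: leq_trans ltp (ag p).
move=> nX; have [e [[Se be lte eP] Ee]] : exists e, X e /\ E e.
  apply: NNPP => no; apply: nX => x Xx; split; first by case: Xx.
  by move=> Ex; apply: no; exists x.
have [p ltp] := vlt_coord (conj ba neq).
(* [b] and [e] agree at [p], so [h] in [E] raises [p] and keeps [i]. Cut down by [a], it gives [s]:
   the inner induction settles [s] in [E], and [below_ideal] settles [s] in [A]. *)
have [h [Eh bh lth hP]] := G2_above g2E Eb Ee be (coord_neq lte) (esym (eP p ltp)).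
have hi := hP i lte.
pose s := vmeet h a.
have bs : vle b s by apply: vle_meet.
have Ss : S s by apply: g1S => //; apply: E_S.
have sp : b p < s p by rewrite vmeetE leq_min lth.
have si : s i = b i by rewrite vmeetE hi eqi minnn.
suff [g [Ag mg sg ltg]] : exists g, [/\ A g, ascent S A m g, vle s g & s i < g i].
  by exists g; split=> //; [apply: vle_trans sg | rewrite -si].
have sa : vle s a by apply: vmeet_ler.
have [Es|nEs] := classic (E s).
  apply: (IHk s _ Es Aa ma sa).2.
  have := weight_lt bs sp; have := weight_le sa; lia.
apply: (below s h i) => //.
- exact: ascent_down sa ma.
- exact: vmeet_lel.
- by rewrite si.
Qed.

Lemma below_above m : below_ideal m /\ above_ideal m.
Proof.
elim/ltn_ind: m => m IH; have Hm := below_ideal_step IH.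
by split=> //; apply: above_ideal_step.
Qed.

Lemma ascent_above_ideal m b a : E b -> A a -> ascent S A m a -> vle b a ->
  ascent S A m.+1 b.
Proof. exact: (below_above m).2. Qed.

(** Take [t] of maximal weight in [A] below [b]; strictly above [t] and up to [b], all of [S] is in
    [E]. A heaviest [s] of this kind lying below an element of [A] with enough ascents must be [b]:
    otherwise [s] ascends once more, and cutting the new element by [b] enlarges [s]. *)
Lemma ascent_ideal n b : E b -> (exists a, A a /\ vle a b) ->
  (forall a, A a -> vle a b -> ascent S A n a) -> ascent S A n b.
Proof.
move=> Eb exA Hn; have Sb := E_S Eb; case: n Hn => // n Hn.
suff [g [Ag ng bg]] : exists g, [/\ A g, ascent S A n g & vle b g].
  exact: ascent_above_ideal ng bg.
have [t [[At tb] maxt]] := minimizer (fun a => weight b - weight a) exA.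
have inE y j : S y -> vle t y -> vle y b -> t j < y j -> E y.
  move=> Sy ty yb lt; apply: NNPP => nEy.
  have := maxt y (conj (conj Sy nEy) yb).
  have := weight_lt ty lt; have := weight_le yb; lia.
have [p ltp] := vlt_coord (conj tb (sdiff_neq At Eb)).
have exs : exists s, [/\ E s, vle t s, vle s b &
    exists g, [/\ A g, ascent S A n g & vle s g]].
  have [g [Ag ng tg ltg]] := (Hn t At tb).2 p; exists (vmeet g b).
  have ts : vle t (vmeet g b) by apply: vle_meet.
  split=> //; [|exact: vmeet_ler|by exists g; split=> //; apply: vmeet_lel].
  apply: (inE _ p) => //; [by apply: g1S => //; case: Ag | exact: vmeet_ler |].
  by rewrite vmeetE leq_min ltg.
have [s [[Es ts sb [g [Ag ng sg]]] maxs]] := minimizer (fun s => weight b - weight s) exs.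
have [eq_sb|neq_sb] := classic (s = b); first by exists g; rewrite -eq_sb.
have [i lti] := vlt_coord (conj sb neq_sb).
have [h [Ah nh sh lth]] := (ascent_above_ideal Es Ag ng sg).2 i.
have sm : vle s (vmeet h b) by apply: vle_meet.
have smi : s i < vmeet h b i by rewrite vmeetE leq_min lth.
have tm := vle_trans ts sm.
have mb : vle (vmeet h b) b by apply: vmeet_ler.
have Em : E (vmeet h b).
  apply: (inE _ i) => //; last exact: leq_ltn_trans (ts i) smi.
  by apply: g1S => //; case: Ah.
suff : weight b - weight s <= weight b - weight (vmeet h b).
  by have := weight_lt sm smi; have := weight_le mb; lia.
by apply: maxs; split=> //; exists h; split=> //; apply: vmeet_lel.
Qed.

End Ideal.

(** * Ascents and the level function *)

Definition leveled d (S E : vset d) N :=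
  [/\ 0 < d, good_semigroup S, good_ideal S E & nlevels S (sdiff S E) N].

Section Leveled.
Variables (d : nat) (S E : vset d) (N : nat).
Hypothesis lev : leveled S E N.
Let A := sdiff S E.

Let d_gt0 : 0 < d. Proof. by case: lev. Qed.
Let g1S : G1 S. Proof. by case: lev => _ []. Qed.
Let g2S : G2 S. Proof. by case: lev => _ []. Qed.
Let g3S : G3 S. Proof. by case: lev => _ []. Qed.
Let g1E : G1 E. Proof. by case: lev => _ _ []. Qed.
Let g2E : G2 E. Proof. by case: lev => _ _ []. Qed.
Let E_S : forall a, E a -> S a. Proof. by case: lev => _ _ []. Qed.

Lemma sdiff_or_ideal a : S a -> A a \/ E a.
Proof. by move=> Sa; have [Ea|nEa] := classic (E a); [right | left]. Qed.

Lemma exists_above a : exists g, S g /\ vll a g.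
Proof.
have [c Hc] := g3S; exists [ffun j => maxn (c j) (a j).+1]; split.
  by apply: Hc => j; rewrite ffunE leq_maxl.
by move=> j; rewrite ffunE leq_maxr.
Qed.

Lemma ascent_sdiff_lt n a : A a -> ascent S A n a -> n < N.
Proof.
move=> Aa na; rewrite ltnNge; apply/negP => le_Nn.
have [_ _ _ [empty _]] := lev; apply: (empty a); apply/remA_ascent => //.
by split=> //; apply: ascent_le na.
Qed.

Lemma ascent_leN n a : ascent S A n a -> n <= N.
Proof.
case: n => // n [_ Ha]; have [g [Ag ng _ _]] := Ha (Ordinal d_gt0).
exact: ascent_sdiff_lt ng.
Qed.

Lemma ascent_exact a : S a -> exists n, ascent S A n a /\ ~ ascent S A n.+1 a.
Proof.
move=> Sa; have [|n [_ na nna]] := ascent_max Sa (N := N.+1) (A := A).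
  by move=> /ascent_leN; rewrite ltnn.
by exists n.
Qed.

Lemma ascent_inhabited n : n < N -> exists a, A a /\ ascent S A n a.
Proof.
have [_ _ _ [_ inh]] := lev => /inh [a /remA_ascent Ha]; exists a; exact: Ha.
Qed.

Lemma ascent_below_sdiff m b a : S b -> ~ A b -> A a -> ascent S A m a ->
  vle b a -> ascent S A m.+1 b.
Proof.
move=> Sb nAb; have [//|Eb] := sdiff_or_ideal Sb.
exact: ascent_above_ideal.
Qed.

End Leveled.

(* An element of the ideal with exactly n ascents has level N - n + 1 rather
   than N - n: it counts as lying above a level instead of inside one. *)
Lemma level_fun_ascent d (S E : vset d) a k :
    0 < d -> good_semigroup S -> good_ideal S E -> S a ->
    level_fun S (sdiff S E) a k ->
  exists N n, [/\ leveled S E N, ascent S (sdiff S E) n a,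
    ~ ascent S (sdiff S E) n.+1 a, 0 < k
    & sdiff S E a /\ k + n = N \/ ~ sdiff S E a /\ k + n = N.+1].
Proof.
move=> d_gt0 gS gE Sa [N [HN Hk]]; exists N.
have lev : leveled S E N by [].
have [_ _ g1S g2S _] := gS; have [E_S _ g1E g2E _] := gE.
have levD k' t : level_set S (sdiff S E) N k' t -> [/\ 0 < k', k' <= N, sdiff S E t,
    ascent S (sdiff S E) (N - k') t & ~ ascent S (sdiff S E) (N - k').+1 t].
  by move=> [/andP [k0 kN] /Dset_ascent []].
case: Hk => [[Aa /levD [k0 kN _ na nna]]|[nAa [[t [/levD [k0 kN At nt nnt] [ta _]]] maxt]]].
  by exists (N - k); split=> //; left; split=> //; lia.
have [//|Ea] := sdiff_or_ideal E Sa.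
(* [t] lies below [a] and so caps its ascents at [N - k.-1]. Conversely, an element of [A] below [a]
   with exactly [m] ascents sits at level [N - m], which is at most [k.-1]. *)
exists (N - k.-1); split=> //; [| | lia | by right; split=> //; lia].
- apply: ascent_ideal => //; first by exists t.
  move=> b Ab ba.
  have [m [mb nmb]] := ascent_exact lev Ab.1.
  have ltmN := ascent_sdiff_lt lev Ab mb.
  apply: (ascent_le d_gt0 _ mb).
  suff : N - m <= k.-1 by lia.
  apply: (maxt _ b); last by split=> //; apply: sdiff_neq Ab Ea.
  split; first lia.
  have -> : N - (N - m) = m by lia.
  exact/Dset_ascent.
- by move=> nna; apply: nnt; apply: ascent_down nna => //; case: At.
Qed.

(* When a lies in the ideal E1, the number of ascents of a exceeds N1 - level
   by one; this accounts for the two cases. *)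
Definition ascent2 d1 d2 (S1 E1 : vset d1) (S2 E2 : vset d2) n a b :=
  exists n1 n2, [/\ ascent S1 (sdiff S1 E1) n1 a, ascent S2 (sdiff S2 E2) n2 b
    & n <= n1 + n2 \/ [/\ sdiff S1 E1 a, sdiff S2 E2 b & n <= (n1 + n2).+1]].

Lemma ascent2_sym d1 d2 (S1 E1 : vset d1) (S2 E2 : vset d2) n a b :
  ascent2 S1 E1 S2 E2 n a b -> ascent2 S2 E2 S1 E1 n b a.
Proof.
by move=> [n1 [n2 [H1 H2 H]]]; exists n2, n1; rewrite addnC; split=> //;
   case: H => [|[]]; [left | right].
Qed.

(** * Adding the ascents of two factors *)

Section Ascent2.
Variables (d1 d2 : nat) (S1 E1 : vset d1) (S2 E2 : vset d2) (N1 N2 : nat).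
Hypotheses (lev1 : leveled S1 E1 N1) (lev2 : leveled S2 E2 N2).
Let A1 := sdiff S1 E1.
Let A2 := sdiff S2 E2.

(** A positive [n1] pays for the raise. If [n1] is 0, (G3) raises [a] freely: a [b] in [A2] keeps
    the pair outside the product ideal at the cost of at most the extra ascent, and any other [b]
    has [n2 > 0] and can be moved up into [A2]. *)
Lemma ascent2_up n a b i : A1 a \/ A2 b -> ascent2 S1 E1 S2 E2 n.+1 a b ->
  exists a' b', [/\ S1 a', S2 b', A1 a' \/ A2 b' & ascent2 S1 E1 S2 E2 n a' b'] /\
    [/\ vle a a', vle b b' & a i < a' i].
Proof.
move=> Aab [n1 [n2 [H1 H2 Hn]]].
have Sa := ascent_sub H1; have Sb := ascent_sub H2.
case: n1 H1 Hn => [|n1] H1 Hn; last first.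
  have [g [Ag ng ag lt]] := H1.2 i; have [Sg _] := Ag.
  exists g, b; split; split=> //; [by left|].
  exists n1, n2; split=> //.
  case: Hn => [|[Aa Ab]]; first by left; lia.
  by right; split=> //; lia.
have [g [Sg ag]] := exists_above lev1 a.
have leg : vle a g by move=> j; apply: ltnW.
have [Ab|nAb] := classic (A2 b).
  exists g, b; split; split=> //; [by right|].
  by exists 0, n2; split=> //; left; case: Hn => [|[]]; lia.
case: Hn => [|[]] // Hn; case: n2 H2 Hn => // n2 H2 Hn.
have d2_gt0 : 0 < d2 by case: lev2.
have [h [Ah nh bh lth]] := H2.2 (Ordinal d2_gt0).
exists g, h; split; split=> //; [by case: Ah|by right|].
by exists 0, n2; split=> //; left; lia.
Qed.

(** As [a] ascends exactly [n1] times, some coordinate [i] is raised by no element of [A1] above [a]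
    with [n1] ascents. At this [i] the raised pair has lost an ascent in the first factor if [a'] is
    in [A1], and in the second if [b'] enters [A2] from outside. *)
Lemma ascent2_down n a b : A1 a -> S2 b ->
  (forall i, exists a' b',
    [/\ S1 a', S2 b', A1 a' \/ A2 b' & ascent2 S1 E1 S2 E2 n a' b'] /\
    [/\ vle a a', vle b b' & a i < a' i]) ->
  ascent2 S1 E1 S2 E2 n.+1 a b.
Proof.
move=> Aa Sb Hi; have [Sa _] := Aa.
have [n1 [H1 nH1]] := ascent_exact lev1 Sa.
have [n2 [H2 nH2]] := ascent_exact lev2 Sb.
exists n1, n2; split=> //.
have [i Hmax] : exists i, forall g, A1 g -> ascent S1 A1 n1 g -> vle a g -> ~ a i < g i.
  apply: NNPP => no; apply: nH1; split=> // i; apply: NNPP => noi; apply: no.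
  by exists i => g Ag ng ag lt; apply: noi; exists g.
have [a' [b' [[Sa' Sb' Aab' [m1 [m2 [M1 M2 Hn]]]] [aa' bb' lti]]]] := Hi i.
have d1_gt0 : 0 < d1 by case: lev1.
have d2_gt0 : 0 < d2 by case: lev2.
have le1 : m1 <= n1.
  rewrite leqNgt; apply/negP => lt; apply: nH1.
  by apply: (ascent_le d1_gt0 lt); apply: ascent_down M1.
have le2 : m2 <= n2.
  rewrite leqNgt; apply/negP => lt; apply: nH2.
  by apply: (ascent_le d2_gt0 lt); apply: ascent_down M2.
have lt1 : A1 a' -> m1 < n1.
  move=> Aa'; rewrite ltnNge; apply/negP => le; apply: (Hmax a') => //.
  exact: ascent_le M1.
have [Ab|nAb] := classic (A2 b).
  right; split=> //; case: Hn => [|[Aa' _]]; first by lia.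
  by have := lt1 Aa'; lia.
have lt2 : A2 b' -> m2 < n2.
  move=> Ab'; rewrite ltnNge; apply/negP => le; apply: nH2.
  apply: (ascent_le d2_gt0 (n := m2.+1)) => //.
  exact: (ascent_below_sdiff lev2 Sb nAb Ab').
left; case: Hn => [|[Aa' Ab']]; last by have := lt1 Aa'; have := lt2 Ab'; lia.
by case: Aab' => [/lt1|/lt2]; lia.
Qed.

End Ascent2.

(** * The product semigroup and its levels *)

Section Product.
Variables d1 d2 : nat.
Implicit Types (x y : vec (d1 + d2)).

Lemma vconcatEl (a : vec d1) (b : vec d2) j : vconcat a b (lshift d2 j) = a j.
Proof. by rewrite ffunE -[lshift d2 j]/(unsplit (inl j)) unsplitK. Qed.

Lemma vconcatEr (a : vec d1) (b : vec d2) j : vconcat a b (rshift d1 j) = b j.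
Proof. by rewrite ffunE -[rshift d1 j]/(unsplit (inr j)) unsplitK. Qed.

Lemma vleft_concat (a : vec d1) (b : vec d2) : vleft (vconcat a b) = a.
Proof. by apply/ffunP => j; rewrite ffunE vconcatEl. Qed.

Lemma vright_concat (a : vec d1) (b : vec d2) : vright (vconcat a b) = b.
Proof. by apply/ffunP => j; rewrite ffunE vconcatEr. Qed.

Lemma vleft_meet x y : vleft (vmeet x y) = vmeet (vleft x) (vleft y).
Proof. by apply/ffunP => j; rewrite !ffunE. Qed.

Lemma vright_meet x y : vright (vmeet x y) = vmeet (vright x) (vright y).
Proof. by apply/ffunP => j; rewrite !ffunE. Qed.

Lemma vle_split x y :
  vle x y <-> vle (vleft x) (vleft y) /\ vle (vright x) (vright y).
Proof.
split=> [le_xy|[lel ler] i]; first by split=> j; rewrite !ffunE.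
case: (split_ordP i) => j ->.
  by have := lel j; rewrite !ffunE.
by have := ler j; rewrite !ffunE.
Qed.

Lemma sprod_G1 (T1 : vset d1) (T2 : vset d2) :
  G1 T1 -> G1 T2 -> G1 (sprod T1 T2).
Proof.
move=> g1 g2 x y [x1 x2] [y1 y2]; rewrite /sprod vleft_meet vright_meet.
by split; [apply: g1 | apply: g2].
Qed.

(** Distinct elements of a product may coincide in one factor, where (G2) is silent; (G3) then
    supplies an element larger in every coordinate. *)
Lemma G2_G3_raise d (T : vset d) a b i : G2 T -> G3 T -> T a -> T b -> a i = b i ->
  exists e, T e /\ a i < e i /\ forall j, j != i ->
    minn (a j) (b j) <= e j /\ (a j <> b j -> e j = minn (a j) (b j)).
Proof.
move=> g2 [c Hc] Ta Tb eqi; have [eq_ab|neq] := classic (a = b); last exact: g2.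
rewrite -eq_ab; exists [ffun j => maxn (c j) (a j).+1]; split.
  by apply: Hc => j; rewrite ffunE leq_maxl.
by rewrite ffunE leq_maxr; split=> // j _; rewrite ffunE; split=> //; lia.
Qed.

Lemma sprod_G2 (T1 : vset d1) (T2 : vset d2) :
  good_semigroup T1 -> good_semigroup T2 -> G2 (sprod T1 T2).
Proof.
move=> [_ _ g11 g12 g13] [_ _ g21 g22 g23] x y [x1 x2] [y1 y2] _ i.
case: (split_ordP i) => k -> eqk.
  have [|e [Te [lt He]]] := G2_G3_raise (i := k) g12 g13 x1 y1.
    by rewrite !ffunE.
  (* The other factor takes the meet, which satisfies the conditions there with equality. *)
  exists (vconcat e (vmeet (vright x) (vright y))); split.
    by rewrite /sprod vleft_concat vright_concat; split=> //; apply: g21.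
  rewrite vconcatEl; split; first by move: lt; rewrite ffunE.
  move=> j; case: (split_ordP j) => l ->; rewrite ?vconcatEl ?vconcatEr ?ffunE //.
  by rewrite (inj_eq (@lshift_inj _ _)) => /He; rewrite !ffunE.
have [|e [Te [lt He]]] := G2_G3_raise (i := k) g22 g23 x2 y2.
  by rewrite !ffunE.
exists (vconcat (vmeet (vleft x) (vleft y)) e); split.
  by rewrite /sprod vleft_concat vright_concat; split=> //; apply: g11.
rewrite vconcatEr; split; first by move: lt; rewrite ffunE.
move=> j; case: (split_ordP j) => l ->; rewrite ?vconcatEl ?vconcatEr ?ffunE //.
by rewrite (inj_eq (@rshift_inj _ _)) => /He; rewrite !ffunE.
Qed.

Variables (S1 E1 : vset d1) (S2 E2 : vset d2) (N1 N2 : nat).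
Hypotheses (lev1 : leveled S1 E1 N1) (lev2 : leveled S2 E2 N2).
Let S := sprod S1 S2.
Let A := sdiff S (sprod E1 E2).

Lemma sdiff_sprod x : A x <->
  [/\ S1 (vleft x), S2 (vright x)
    & sdiff S1 E1 (vleft x) \/ sdiff S2 E2 (vright x)].
Proof.
split=> [[[x1 x2] nE]|[x1 x2 nE]].
  split=> //; have [Ex1|nEx1] := classic (E1 (vleft x)); last by left.
  by right; split=> // Ex2; apply: nE.
by split=> // -[Ex1 Ex2]; case: nE => -[_]; apply.
Qed.

Lemma ascent_sprod n x : A x ->
  ascent S A n x <-> ascent2 S1 E1 S2 E2 n (vleft x) (vright x).
Proof.
elim: n x => [|n IHn] x Ax; have [x1 x2 Ax12] := (sdiff_sprod x).1 Ax.
  by split=> _ //; exists 0, 0; split=> //; left.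
split=> [[_ Hx]|Hx].
  (* [ascent2_down] only asks to raise the coordinates of a factor whose component lies outside its
     ideal; the second factor follows by symmetry. *)
  case: Ax12 => [Ax1|Ax2].
    apply: (ascent2_down lev1 lev2) => // i.
    have [y [Ay ny le_xy lt]] := Hx (lshift d2 i).
    have [y1 y2 Ay12] := (sdiff_sprod y).1 Ay; have [le1 le2] := (vle_split x y).1 le_xy.
    exists (vleft y), (vright y); split; split=> //; first exact/IHn.
    by rewrite !ffunE.
  apply: ascent2_sym; apply: (ascent2_down lev2 lev1) => // i.
  have [y [Ay ny le_xy lt]] := Hx (rshift d1 i).
  have [y1 y2 Ay12] := (sdiff_sprod y).1 Ay; have [le1 le2] := (vle_split x y).1 le_xy.
  exists (vright y), (vleft y); split; split=> //.
  - by case: Ay12; [right | left].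
  - by apply: ascent2_sym; apply/IHn.
  - by rewrite !ffunE.
have wit a b i : S1 a -> S2 b -> sdiff S1 E1 a \/ sdiff S2 E2 b ->
    ascent2 S1 E1 S2 E2 n a b -> vle (vleft x) a -> vle (vright x) b ->
    x i < vconcat a b i -> exists y, [/\ A y, ascent S A n y, vle x y & x i < y i].
  move=> Sa Sb Aab nab xa xb lt.
  have Ay : A (vconcat a b) by apply/sdiff_sprod; rewrite vleft_concat vright_concat.
  exists (vconcat a b); split=> //.
    by apply/IHn => //; rewrite vleft_concat vright_concat.
  by apply/vle_split; rewrite vleft_concat vright_concat.
split; first by case: Ax.
move=> i; case: (split_ordP i) => j ->.
  have [a [b [[Sa Sb Aab nab] [xa xb lt]]]] := ascent2_up lev1 lev2 j Ax12 Hx.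
  apply: (wit a b) => //; rewrite vconcatEl; by move: lt; rewrite ffunE.
have Ax21 : sdiff S2 E2 (vright x) \/ sdiff S1 E1 (vleft x).
  by case: Ax12; [right | left].
have [b [a [[Sb Sa Aba nba] [xb xa lt]]]] :=
  ascent2_up lev2 lev1 j Ax21 (ascent2_sym Hx).
apply: (wit a b) => //; [by case: Aba; [right | left] | exact: ascent2_sym |].
by rewrite vconcatEr; move: lt; rewrite ffunE.
Qed.

Lemma remA_sprod n x : remA S A n x <->
  A x /\ ascent2 S1 E1 S2 E2 n (vleft x) (vright x).
Proof.
have [d1_gt0 gS1 [_ _ g1E1 _ _] _] := lev1; have [_ gS2 [_ _ g1E2 _ _] _] := lev2.
have [_ _ g11 _ _] := gS1; have [_ _ g21 _ _] := gS2.
have d_gt0 : 0 < d1 + d2 by rewrite addn_gt0 d1_gt0.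
have remE := remA_ascent d_gt0 (sprod_G1 g11 g21) (sprod_G2 gS1 gS2) (sprod_G1 g1E1 g1E2).
split=> [/remE [Ax]|[Ax nx]]; first by move=> nx; split=> //; apply/(ascent_sprod n Ax).
by apply/remE; split=> //; apply/ascent_sprod.
Qed.

Lemma nlevels_sprod : 0 < N1 -> 0 < N2 -> nlevels S A (N1 + N2).
Proof.
move=> N1_gt0 N2_gt0; split=> [x /remA_sprod [Ax [n1 [n2 [H1 H2 Hn]]]]|n ltn].
  have le1 := ascent_leN lev1 H1; have le2 := ascent_leN lev2 H2.
  have := ascent_sdiff_lt lev1 (n := n1) (a := vleft x).
  have := ascent_sdiff_lt lev2 (n := n2) (a := vright x).
  case/sdiff_sprod: Ax => _ _ [Aa|Ab] lt2 lt1; case: Hn => [|[Aa' Ab']] Hn.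
  - by have := lt1 Aa H1; lia.
  - by have := lt1 Aa H1; have := lt2 Ab' H2; lia.
  - by have := lt2 Ab H2; lia.
  - by have := lt2 Ab H2; have := lt1 Aa' H1; lia.
(* [a] takes as many of the [n] ascents as an element outside [E1] can have, [b] takes the rest, and
   the extra ascent makes up for the cap [N1.-1]. *)
have [a [Aa Ha]] : exists a, sdiff S1 E1 a /\ ascent S1 (sdiff S1 E1) (minn n N1.-1) a.
  by apply: (ascent_inhabited lev1); lia.
have [b [Ab Hb]] : exists b, sdiff S2 E2 b /\ ascent S2 (sdiff S2 E2) (n - N1) b.
  by apply: (ascent_inhabited lev2); lia.
exists (vconcat a b); apply/remA_sprod.
split; first by apply/sdiff_sprod; rewrite vleft_concat vright_concat;
  split; [case: Aa | case: Ab | left].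
rewrite vleft_concat vright_concat; exists (minn n N1.-1), (n - N1); split=> //.
by right; split=> //; lia.
Qed.

End Product.

Theorem theorem4p4 (d1 d2 : nat) (S1 E1 : vset d1) (S2 E2 : vset d2) :
  0 < d1 -> 0 < d2 ->
  good_semigroup S1 -> good_semigroup S2 ->
  good_ideal S1 E1 -> good_ideal S2 E2 ->
  proper_in S1 E1 -> proper_in S2 E2 ->
  forall (a1 : vec d1) (a2 : vec d2) (k1 k2 : nat),
    sdiff (sprod S1 S2) (sprod E1 E2) (vconcat a1 a2) ->
    level_fun S1 (sdiff S1 E1) a1 k1 ->
    level_fun S2 (sdiff S2 E2) a2 k2 ->
    in_level (sprod S1 S2) (sdiff (sprod S1 S2) (sprod E1 E2))
             (k1 + k2 - 1) (vconcat a1 a2).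
Proof.
move=> d1_gt0 d2_gt0 gS1 gS2 gE1 gE2 [p1 Ap1] [p2 Ap2] a1 a2 k1 k2 Ax L1 L2.
have := (sdiff_sprod _ _ _ _ _).1 Ax; rewrite vleft_concat vright_concat.
move=> [Sa1 Sa2 Aa12].
have [N1 [n1 [lev1 H1 nH1 k1_gt0 Hk1]]] := level_fun_ascent d1_gt0 gS1 gE1 Sa1 L1.
have [N2 [n2 [lev2 H2 nH2 k2_gt0 Hk2]]] := level_fun_ascent d2_gt0 gS2 gE2 Sa2 L2.
have N1_gt0 : 0 < N1 by apply: leq_trans (ascent_sdiff_lt lev1 (n := 0) Ap1 Ap1.1).
have N2_gt0 : 0 < N2 by apply: leq_trans (ascent_sdiff_lt lev2 (n := 0) Ap2 Ap2.1).
have le1 := ascent_leN lev1 H1; have le2 := ascent_leN lev2 H2.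
have lt1 := ascent_sdiff_lt lev1 (n := n1) (a := a1).
have lt2 := ascent_sdiff_lt lev2 (n := n2) (a := a2).
exists (N1 + N2); split; first exact: nlevels_sprod.
split.
  by case: Hk1 => -[? ?]; case: Hk2 => -[? ?]; case: Aa12 => // ?; lia.
(* This is [n1 + n2 + 1] when both components lie outside the ideals and [n1 + n2] when exactly one
   does, matching the two alternatives of [ascent2]. *)
set n := N1 + N2 - _.
have Hn : ascent2 S1 E1 S2 E2 n a1 a2.
  exists n1, n2; split=> //.
  case: Hk1 => -[A1 ?]; case: Hk2 => -[A2 ?].
  - by right; split=> //; lia.
  - by left; lia.
  - by left; lia.
  - by case: Aa12.
have nHn : ~ ascent2 S1 E1 S2 E2 n.+1 a1 a2.
  move=> [m1 [m2 [M1 M2 Hm]]].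
  have le1' : m1 <= n1.
    by rewrite leqNgt; apply/negP => lt; apply: nH1; apply: ascent_le M1.
  have le2' : m2 <= n2.
    by rewrite leqNgt; apply/negP => lt; apply: nH2; apply: ascent_le M2.
  case: Hk1 => -[A1 ?]; case: Hk2 => -[A2 ?]; case: Hm => [Hm|[B1 B2 Hm]] //;
    by case: Aa12 => // _; lia.
have remE m := remA_sprod lev1 lev2 m (vconcat a1 a2).
rewrite vleft_concat vright_concat in remE.
have Rn := (remE n).2 (conj Ax Hn).
apply: NNPP => nD; apply: nHn.
by have [] := (remE n.+1).1 (conj Rn nD).
Qed.
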